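(* For every integer $N$ there is a finite graph $G$ with $\operatorname{odw}(G)\ge N$ in which every geodesic cycle has length three.
   Context: $d_G(u,v)$ denotes the length of a shortest $u$–$v$ path in $G$. A connected subgraph $C$ of $G$ is geodesic if $d_C(u,v)=d_G(u,v)$ for all $u,v\in V(C)$. A tree-decomposition of $G$ is a pair $(T,(B_t:t\in V(T)))$ where $T$ is a tree and $B_t\subseteq V(G)$, such that $V(G)=\bigcup_t B_t$; every edge has both ends in some $B_t$; and if $t_2$ lies on the $T$-path between $t_1,t_3$ then $B_{t_1}\cap B_{t_3}\subseteq B_{t_2}$. Its outer diameter is $\max_t\max_{u,v\in B_t}d_G(u,v)$, and $\operatorname{odw}(G)$ is the minimum outer diameter over all tree-decompositions of $G$. *)

(* Defs.v *)
From HB Require Import structures.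
From mathcomp Require Import all_boot all_order all_algebra.
From mathcomp Require Import boolp constructive_ereal.

Set Implicit Arguments.
Unset Strict Implicit.
Unset Printing Implicit Defensive.

Import Order.TTheory GRing.Theory Num.Theory.

(* Simple graphs.  The vertex type may be infinite, because the tree of a
   tree-decomposition is not required to be finite; [G] is a finite graph when
   [V] is a finType. *)
Record graph (V : eqType) := Graph {
  adj :> rel V;
  adj_sym : symmetric adj;
  adj_irr : irreflexive adj }.

(* [x :: p] is the vertex sequence of a path from [x] to [y], of length
   [size p]. *)
Definition path_from_to (V : eqType) (e : rel V) (x y : V) (p : seq V) : bool :=
  [&& path e x p, uniq (x :: p) & last x p == y].

Definition connected (V : eqType) (S : pred V) (e : rel V) : Prop :=
  (exists x, S x) /\
  (forall x y, S x -> S y -> exists p, all S p && path_from_to e x y p).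

(* The value is [+oo] when there is no path from [u] to [v]; bounding the length
   by [#|V|] loses nothing, since the vertices of a path are distinct. *)
Definition dist (V : finType) (e : rel V) (u v : V) : \bar int :=
  \big[Order.min/+oo%E]_(n < #|V| | [exists p : n.-tuple V, path_from_to e u v p])
    (n%:Z)%:E.

Record subgraph (V : finType) (G : graph V) := Subgraph {
  sub_vert : {set V};
  sub_adj : graph V;
  sub_adj_vert : forall x y,
    sub_adj x y -> (x \in sub_vert) && (y \in sub_vert);
  sub_adj_sub : subrel sub_adj G }.

Definition geodesic (V : finType) (G : graph V) (C : subgraph G) : Prop :=
  connected (mem (sub_vert C)) (sub_adj C) /\
  {in sub_vert C &, forall u v, dist (sub_adj C) u v = dist G u v}.

Definition is_cycle_of_length (V : finType) (G : graph V) (C : subgraph G)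
    (n : nat) : Prop :=
  exists c : seq V,
    [/\ uniq c, size c = n, 3 <= n, sub_vert C =i c &
        forall x y, sub_adj C x y =
          [&& x \in c, y \in c & (next c x == y) || (next c y == x)]].

Definition is_tree (V : eqType) (T : graph V) : Prop :=
  connected predT T /\ (forall c : seq V, ucycle T c -> size c < 3).

Record tree_decomposition (V : finType) (G : graph V) := TreeDecomposition {
  td_node : eqType;
  td_tree : graph td_node;
  td_treeP : is_tree td_tree;
  bag : td_node -> {set V};
  bag_cover : forall v, exists t, v \in bag t;
  bag_edge : forall u v, G u v -> exists t, (u \in bag t) && (v \in bag t);
  bag_interpolation : forall t1 t2 t3 p,
    path_from_to td_tree t1 t3 p -> t2 \in t1 :: p ->
    bag t1 :&: bag t3 \subset bag t2 }.

Arguments bag {V G} D t : rename.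

(* The maximum over all nodes [t] and all [u], [v] in the bag at [t], written as
   a maximum over the finitely many pairs [(u, v)] that share some bag, so that
   it makes sense for an infinite tree. *)
Definition outer_diameter (V : finType) (G : graph V)
    (D : tree_decomposition G) : \bar int :=
  \big[Order.max/0%E]_(uv : V * V |
      `[< exists t, (uv.1 \in bag D t) && (uv.2 \in bag D t) >])
    dist G uv.1 uv.2.

(* Some tree-decomposition has finite outer diameter, even when [G] is
   disconnected: a star whose leaves carry the components of [G]. *)
Section ComponentStar.
Variables (V : finType) (G : graph V).

Definition star_rel : rel (option V) := fun x y => (x == None) != (y == None).

Lemma star_sym : symmetric star_rel.
Proof. by move=> x y; rewrite /star_rel eq_sym. Qed.

Lemma star_irr : irreflexive star_rel.
Proof. by move=> x; rewrite /star_rel eqxx. Qed.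

Definition star : graph (option V) := Graph star_sym star_irr.

Lemma star_tree : is_tree star.
Proof.
split.
  split=> [|x y _ _]; first by exists None.
  have [<-|nxy] := eqVneq x y.
    by exists [::]; rewrite /path_from_to /= eqxx.
  case: x y nxy => [x|] [y|] // nxy.
  - by exists [:: None; Some y]; rewrite /path_from_to /= !inE eqxx nxy.
  - by exists [:: None]; rewrite /path_from_to.
  - by exists [:: Some y]; rewrite /path_from_to /= eqxx.
case=> [|x [|y [|z [|w c]]]] //; rewrite /ucycle /= /star_rel !inE.
  by case: x y z => [x|] [y|] [z|].
by case: x y z w => [x|] [y|] [z|] [w|]; rewrite //= ?andbF ?orbT ?andbF.
Qed.

Definition star_bag (t : option V) : {set V} :=
  if t is Some r then [set v | fingraph.root G v == r] else set0.

Lemma star_bagP v t : v \in star_bag t -> t = Some (fingraph.root G v).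
Proof. by case: t => [r|]; rewrite !inE // => /eqP->. Qed.

Lemma graph_connect_sym : connect_sym G.
Proof. exact: sym_connect_sym (adj_sym G). Qed.

Lemma star_cover v : exists t, v \in star_bag t.
Proof. by exists (Some (fingraph.root G v)); rewrite inE. Qed.

Lemma star_edge u v :
  G u v -> exists t, (u \in star_bag t) && (v \in star_bag t).
Proof.
move=> uv; exists (Some (fingraph.root G v)).
by rewrite !inE eqxx (root_connect graph_connect_sym) connect1.
Qed.

Lemma star_interpolation t1 t2 t3 p :
  path_from_to star t1 t3 p -> t2 \in t1 :: p ->
  star_bag t1 :&: star_bag t3 \subset star_bag t2.
Proof.
move=> /and3P[_ up lp] t2p; apply/subsetP => v /setIP[v1 v3].
have t13 : t3 = t1 by rewrite (star_bagP v1) (star_bagP v3).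
move: up lp t2p; rewrite t13; case: p => [|y p] /=.
  by rewrite inE => _ _ /eqP->.
by case/andP=> t1p _ /eqP lp; rewrite -lp mem_last in t1p.
Qed.

Definition component_star : tree_decomposition G :=
  TreeDecomposition star_tree star_cover star_edge star_interpolation.

Lemma dist_connect u v : connect G u v -> exists n : nat, dist G u v = (n%:Z)%:E.
Proof.
case/connectP=> p0 /shortenP[p pp up _] vE.
have sp : size p < #|V| by rewrite -[_.+1]/(size (u :: p)) -(card_uniqP up) max_card.
have : (dist G u v <= ((size p)%:Z)%:E)%O.
  apply: (bigmin_le_cond _ (j := Ordinal sp)).
  by apply/existsP; exists (in_tuple p); rewrite /path_from_to pp up vE eqxx.
have : dist G u v = +oo%E \/ exists n : nat, dist G u v = (n%:Z)%:E.
  rewrite /dist; elim/big_ind: _ => [|x y|n _]; first by left.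
  - by rewrite minEle; case: ifP.
  - by right; exists n.
by case=> [->|//].
Qed.

Lemma odw_ex :
  exists k : nat, `[< exists D : tree_decomposition G, outer_diameter D = (k%:Z)%:E >].
Proof.
suff [k kE] : exists k : nat, outer_diameter component_star = (k%:Z)%:E.
  by exists k; apply/asboolP; exists component_star.
rewrite /outer_diameter; elim/big_ind: _ => [|x y Hx Hy|[u v] /asboolP[t]].
- by exists 0.
- by rewrite maxEle; case: ifP.
case/andP=> /star_bagP /= -> /star_bagP /= [/eqP].
by rewrite (root_connect graph_connect_sym) => /dist_connect.
Qed.

End ComponentStar.

Definition odw (V : finType) (G : graph V) : nat := ex_minn (odw_ex G).

(* Main.v *)
(* The graph is a rhombic piece of the triangular lattice, where distances are
   given by the hexagonal norm.  In that norm the neighbours of v lying on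
   geodesics from v to a fixed u form a clique.  Applied to a vertex v of an even
   geodesic cycle and its antipode u, this makes the two cycle neighbours of v
   adjacent, which is absurd.  On an odd cycle of length at least five the same
   conclusion follows from the two antipodes of v.
   For the lower bound, the crosses (a row together with a column) are connected
   and pairwise intersecting, so by the Helly property of subtrees some bag
   meets all of them.  Such a bag meets all rows or all columns, hence two
   opposite sides of the rhombus. *)
Require Import Defs.
From mathcomp Require Import all_boot all_order all_algebra.
From mathcomp Require Import boolp constructive_ereal zify.

Set Implicit Arguments.
Unset Strict Implicit.
Unset Printing Implicit Defensive.

Import Order.TTheory.

(** * Certificates for graph distances *)

Lemma dist_eq (V : finType) (e : rel V) (x y : V) (n : nat) :
  (forall p, path_from_to e x y p -> n <= size p) ->
  (exists2 p, path e x p & last x p = y /\ size p <= n) ->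
  dist e x y = (n%:Z)%:E.
Proof.
move=> lb [p0 pp0 [lp0]].
case: (shortenP pp0) lp0 => p pp up sub lp sp0.
have spn : size p <= n.
  by apply: leq_trans sp0; apply: uniq_leq_size; [case/andP: up | apply: sub].
have pft : path_from_to e x y p by rewrite /path_from_to pp up lp eqxx.
have sp : size p = n by apply/eqP; rewrite eqn_leq spn lb.
have spV : size p < #|V| by rewrite -[_.+1]/(size (x :: p)) -(card_uniqP up) max_card.
apply/eqP; rewrite eq_le; apply/andP; split.
  rewrite -sp; apply: (bigmin_le_cond _ (j := Ordinal spV)).
  by apply/existsP; exists (in_tuple p).
apply/bigmin_geP; split; first by rewrite leey.
by move=> i /existsP[q /lb]; rewrite size_tuple lee_fin.
Qed.

(** The Lipschitz condition bounds every path from below, and descending along [f] gives a walk of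
    length [f x]. The predicate [S] confines the descent to vertices where [f] is meaningful. *)
Lemma dist_potential (V : finType) (e : rel V) (S : pred V) (y : V) (f : V -> nat) :
  f y = 0 ->
  (forall a b, e a b -> f a <= (f b).+1) ->
  (forall a, S a -> f a = 0 -> a = y) ->
  (forall a, S a -> 0 < f a -> exists b, [/\ S b, e a b & f a = (f b).+1]) ->
  forall x, S x -> dist e x y = ((f x)%:Z)%:E.
Proof.
move=> fy lip f0 desc x Sx; apply: dist_eq => [p /and3P[pp _ /eqP lp]|].
  elim: p x {Sx} pp lp => [|z p IH] x /=; first by move=> _ ->; rewrite fy.
  by case/andP=> /lip xz /IH/[apply] zp; apply: leq_trans xz _.
move: {-1}(f x) (erefl (f x)) => n; elim: n x Sx => [|n IH] x Sx fx.
  by exists [::] => //; rewrite (f0 x).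
have [|b [Sb xb]] := desc _ Sx; first by rewrite fx.
rewrite fx => -[fb]; have [p pp [lp sp]] := IH _ Sb (esym fb).
by exists (b :: p); rewrite /= ?xb.
Qed.

(** * Convex sets of tree nodes and their Helly property *)

Section Convexity.

Variables (T : eqType) (e : rel T).
Hypotheses (e_sym : symmetric e)
  (e_conn : forall x y, exists p, path_from_to e x y p).

Definition between (x t y : T) : Prop :=
  exists2 p, path_from_to e x y p & t \in x :: p.

(** In a tree these are the node sets of subtrees, together with the empty set. *)
Definition convex (A : T -> Prop) : Prop :=
  forall x t y, A x -> A y -> between x t y -> A t.

(** Here [q] stops just before [m]; the default in [head m q] covers an empty [q], when the glued
    path starts at [m]. *)
Lemma between_glue q m r t : sorted e (rcons q m) -> path e m r ->
  uniq q -> uniq (m :: r) -> ~~ has (mem (m :: r)) q -> t \in m :: r ->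
  between (head m q) t (last m r).
Proof.
move=> eq er uq ur dis tr.
have [el ul] : sorted e (q ++ m :: r) /\ uniq (q ++ m :: r).
  by split; rewrite ?sorted_cat_cons ?eq ?er // cat_uniq uq ur has_sym dis.
have tl : t \in q ++ m :: r by rewrite mem_cat tr orbT.
case: q {eq uq dis} el ul tl => [|x q] /= el ul tl.
  by exists r => //; apply/and3P; split.
by exists (q ++ m :: r) => //; apply/and3P; split=> //; rewrite last_cat.
Qed.

(* [m] is the first vertex of [a :: p] on a path from [s] to [a]. *)
Lemma tripod a b p s : path_from_to e a b p ->
  exists m, [/\ m \in a :: p, between s m a, between s m b &
    forall t, t \in a :: p -> between s t a \/ between s t b].
Proof.
move=> /and3P[pp up /eqP lp].
have [q /and3P[pq uq /eqP lq]] := e_conn s a.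
have hq : has (mem (a :: p)) (s :: q).
  by apply/hasP; exists a; [rewrite -lq mem_last | apply: mem_head].
have [q1 [m [hs mp dis eq1 uq1]]] : exists q1 m, [/\ s = head m q1,
    m \in a :: p, ~~ has (mem (a :: p)) q1, sorted e (rcons q1 m) & uniq q1].
  have {}pq : sorted e (s :: q) by [].
  move: pq uq (erefl s); rewrite -{3}[s]/(head s (s :: q)).
  case: (split_find hq) => m q1 q2 mp dis.
  rewrite cat_uniq rcons_uniq => /cat_sorted2[eq1 _] /andP[/andP[_ uq1] _] hs.
  by exists q1, m; split=> //; rewrite -{1}hs; case: (q1).
have [p1 [p2 pE]] : exists p1 p2, a :: p = p1 ++ m :: p2.
  by case/splitPr: mp => p1 p2; exists p1, p2.
have ep : sorted e (p1 ++ m :: p2) by rewrite -pE.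
move: ep up dis; rewrite pE sorted_cat_cons cat_uniq.
move=> /andP[ep1 ep2] /and3P[up1 dis12 up2] dis.
have inP x : x \in q1 -> (x \notin p1) && (x \notin m :: p2).
  by move=> xq; rewrite -negb_or -mem_cat; apply: contra dis => xp; apply/hasP; exists x.
have lb : last m p2 = b by have := congr1 (last a) pE; rewrite last_cat /= lp.
have la : last m (rev p1) = a.
  by case: p1 pE {ep1 up1 dis12 dis inP} => [|x p1] [<- _] //; rewrite rev_cons last_rcons.
(* The part of [a :: p] before [m], read backwards, leads from [m] to [a]. *)
have em1 : path e m (rev p1).
  rewrite -[path _ _ _]/(sorted e (m :: rev p1)) -rev_rcons rev_sorted.
  by rewrite (eq_sorted (e' := e)) // => x y; rewrite e_sym.
have um1 : uniq (m :: rev p1).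
  rewrite /= rev_uniq up1 mem_rev andbT; apply: contra dis12 => mp1.
  by apply/hasP; exists m; rewrite ?mem_head.
have sb t : t \in m :: p2 -> between s t b.
  rewrite hs -lb; apply: between_glue => //.
  by apply/hasPn => x /inP/andP[].
have sa t : t \in m :: rev p1 -> between s t a.
  rewrite hs -la; apply: between_glue => //.
  by apply/hasPn => x /inP/andP[]; rewrite !inE mem_rev !negb_or => -> /andP[->].
exists m; split; [|exact/sa/mem_head|exact/sb/mem_head|move=> t].
  by rewrite mem_cat mem_head orbT.
rewrite mem_cat => /orP[tp1|/sb]; last by right.
by left; apply: sa; rewrite inE mem_rev tp1 orbT.
Qed.

Lemma eq_convex (A B : T -> Prop) :
  (forall t, A t <-> B t) -> convex A -> convex B.
Proof. by move=> AB cA x t y /AB Ax /AB Ay xty; apply/AB; apply: cA xty. Qed.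

(** By [tripod], each node on a path from [x] in one set to [y] in the other lies on a path from [s]
    to [x] or from [s] to [y], hence stays within one set. *)
Lemma convex_setU A B s : convex A -> convex B -> A s -> B s ->
  convex (fun t => A t \/ B t).
Proof.
move=> cA cB As Bs.
suff main C D : convex C -> convex D -> C s -> D s -> forall x t y, C x -> D y ->
    between x t y -> C t \/ D t.
  move=> x t y [Ax|Bx] [Ay|By] xty.
  - by left; apply: cA xty.
  - exact: (main A B) xty.
  - by apply/or_comm; apply: (main B A) xty.
  - by right; apply: cB xty.
move=> cC cD Cs Ds x t y Cx Dy [p xp tp].
have [m [_ _ _ /(_ t tp)[] st]] := tripod s xp.
  by left; apply: cC st.
by right; apply: cD st.
Qed.

Lemma convex_setI A B : convex A -> convex B -> convex (fun t => A t /\ B t).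
Proof.
by move=> cA cB x t y [Ax Bx] [Ay By] xty; split; [apply: cA xty|apply: cB xty].
Qed.

(** The centre of the tripod on [a], [b], [c] lies on a path between each two of them, and each set
    contains two of them. *)
Lemma convex_median A B C a b c : convex A -> convex B -> convex C ->
  B a -> C a -> A b -> C b -> A c -> B c -> exists t, [/\ A t, B t & C t].
Proof.
move=> cA cB cC Ba Ca Ab Cb Ac Bc; have [p ap] := e_conn a b.
have [m [mp cma cmb _]] := tripod c ap.
by exists m; split; [apply: cA cmb|apply: cB cma|apply: (cC a m b)=> //; exists p].
Qed.

(** Induction on [s], replacing every [F i] by its intersection with [F j]; by [convex_median] these
    still meet pairwise. *)
Lemma convex_Helly (I : eqType) (F : I -> T -> Prop) :
  (forall i, convex (F i)) ->
  (forall i j, exists t, F i t /\ F j t) ->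
  forall i0 (s : seq I), exists t, F i0 t /\ forall i, i \in s -> F i t.
Proof.
move=> cF FF i0 s; elim: s F cF FF => [|j s IH] F cF FF.
  by have [t []] := FF i0 i0; exists t.
have [||t [[F0 Fj] Fs]] := IH (fun i t => F i t /\ F j t).
- by move=> i; apply: convex_setI.
- move=> i k; have [a [ak aj]] := FF k j; have [b [bi bj]] := FF i j.
  have [c [ci ck]] := FF i k.
  have [t [ti tk tj]] := convex_median (cF i) (cF k) (cF j) ak aj bi bj ci ck.
  by exists t.
exists t; split=> // i; rewrite inE => /predU1P[->//|/Fs[]//].
Qed.

End Convexity.

(** * Traces of walks in a tree-decomposition *)

Lemma tree_connected (T : eqType) (e : graph T) :
  is_tree e -> forall x y, exists p, path_from_to e x y p.
Proof.
by case=> -[_ con] _ x y; have [p /andP[_ xpy]] := con x y isT isT; exists p.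
Qed.

(** Each vertex has a convex trace, and the traces of consecutive vertices meet in a node whose bag
    contains their edge, so unions stay convex. *)
Lemma walk_convex (V : finType) (G : graph V) (D : tree_decomposition G)
    (f : nat -> V) n :
  (forall i, i < n -> G (f i) (f i.+1)) ->
  convex (td_tree D) (fun t => exists2 i, i <= n & f i \in bag D t).
Proof.
have conn := tree_connected (td_treeP D).
have cbag v : convex (td_tree D) (fun t => v \in bag D t).
  move=> x t y xv yv [p xp tp].
  by apply: (subsetP (bag_interpolation xp tp)); rewrite inE xv.
elim: n => [|n IH] adjf.
  move=> x t y [i]; rewrite leqn0 => /eqP-> fx [j]; rewrite leqn0 => /eqP-> fy xty.
  by exists 0 => //; apply: cbag xty.
have [s /andP[s1 s2]] := bag_edge D (adjf n (ltnSn n)).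
have cU := convex_setU (adj_sym _) conn (IH _) (cbag (f n.+1)) (s := s).
apply: eq_convex (cU _ _ s2) => [t||]; last by exists n.
  split=> [[[i le_in fi]|fn]|[i]]; [by exists i; rewrite ?leqW | by exists n.+1 |].
  by rewrite leq_eqVlt => /predU1P[->|le_in fi]; [right | left; exists i].
by move=> i lt_in; apply: adjf; apply: ltnW.
Qed.

(** * The hexagonal norm *)

Definition ndist (i j : nat) : nat := (i - j) + (j - i).

Lemma ndistC i j : ndist i j = ndist j i.
Proof. exact: addnC. Qed.

Lemma ndist0 i : ndist i i = 0.
Proof. by rewrite /ndist subnn. Qed.

Lemma ndist_le i j k : (ndist i j <= k) = (i <= j + k) && (j <= i + k).
Proof. by rewrite /ndist; lia. Qed.

(* The norm max(|x|, |y|, |x - y|), whose unit ball is the hexagon spanned by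
   (1,0), (1,1), (0,1) and their negatives. *)
Definition hex (u v : nat * nat) : nat :=
  maxn (maxn (ndist u.1 v.1) (ndist u.2 v.2)) (ndist (u.1 + v.2) (v.1 + u.2)).

Lemma hexC u v : hex u v = hex v u.
Proof. by congr (maxn (maxn _ _) _); apply: ndistC. Qed.

Lemma hex0 u : hex u u = 0.
Proof. by rewrite /hex !ndist0. Qed.

(** This linear form brings statements about [hex] within reach of [lia]. *)
Lemma hex_le u v k : (hex u v <= k) =
  [&& u.1 <= v.1 + k, v.1 <= u.1 + k, u.2 <= v.2 + k, v.2 <= u.2 + k,
      u.1 + v.2 <= v.1 + u.2 + k & v.1 + u.2 <= u.1 + v.2 + k].
Proof. by rewrite /hex !geq_max !ndist_le -!andbA. Qed.

Lemma hex_triangle u v w : hex u w <= hex u v + hex v w.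
Proof.
have := leqnn (hex u v); have := leqnn (hex v w); rewrite 3!hex_le.
by move: (hex _ _) (hex _ _) => ? ?; lia.
Qed.

(** Seen from [v], the point [u] lies in a sector spanned by two adjacent unit vectors, and only
    steps along these can approach [u]. *)
Lemma hex_even u v p q k : hex v p <= 1 -> hex v q <= 1 -> k < hex u v ->
  hex u p <= k -> hex u q <= k -> hex p q <= 1.
Proof.
rewrite [k < _]ltnNge !hex_le.
by case: u v p q => [? ?] [? ?] [? ?] [? ?] /=; lia.
Qed.

(** Both [u1] and [u2] are at distance [k.+1] from [v] and at most one apart, so they share a sector
    seen from [v]; its two spanning directions are the only ones approaching either. *)
Lemma hex_odd u1 u2 v p q k : hex u1 u2 <= 1 -> hex v p <= 1 -> hex v q <= 1 ->
  hex u1 v <= k.+1 -> hex u2 v <= k.+1 ->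
  k < hex u1 v -> k < hex u2 v ->
  hex u1 p <= k -> hex u2 q <= k -> k < hex u2 p -> hex p q <= 1.
Proof.
rewrite ![k < _]ltnNge !hex_le.
by case: u1 u2 v p q => [? ?] [? ?] [? ?] [? ?] [? ?] /=; lia.
Qed.

Lemma hex_eq0 u v : hex u v <= 0 -> u = v.
Proof. by case: u v => [? ?] [? ?]; rewrite hex_le /= => ?; congr pair; lia. Qed.

Lemma hex_step n u v : u.1 < n -> u.2 < n -> v.1 < n -> v.2 < n ->
  0 < hex u v -> exists w, [/\ w.1 < n, w.2 < n,
    hex u w = 1 & hex u v = (hex w v).+1].
Proof.
move=> u1 u2 v1 v2; case huv: (hex u v) => [//|k] _.
suff [w [w1 w2 uw wv]] : exists w, [/\ w.1 < n, w.2 < n, hex u w <= 1 & hex w v <= k].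
  by exists w; have := hex_triangle u w v; split; lia.
have := leqnn k.+1; rewrite -{1}huv hex_le.
case: u v u1 u2 v1 v2 huv => [a b] [c d] /= u1 u2 v1 v2 huv.
have {}huv : (a, b) <> (c, d) by move=> ab; rewrite ab hex0 in huv.
have {}huv : a = c -> b <> d by move=> ac bd; apply: huv; rewrite ac bd.
case: (ltngtP a c) huv => ac huv; case: (ltngtP b d) huv => bd huv kP.
(* Coordinates only move towards those of [v], so the step stays in the rhombus. Both move exactly
   when they have to change in the same direction. *)
- by exists (a.+1, b.+1); rewrite !hex_le /=; split; lia.
- by exists (a.+1, b); rewrite !hex_le /=; split; lia.
- by exists (a.+1, b); rewrite !hex_le /=; split; lia.
- by exists (a.-1, b); rewrite !hex_le /=; split; lia.
- by exists (a.-1, b.-1); rewrite !hex_le /=; split; lia.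
- by exists (a.-1, b); rewrite !hex_le /=; split; lia.
- by exists (a, b.+1); rewrite !hex_le /=; split; lia.
- by exists (a, b.-1); rewrite !hex_le /=; split; lia.
- by have := huv ac.
Qed.

(** * The rhombus in the triangular lattice *)

Definition pt n (u : 'I_n * 'I_n) : nat * nat := (u.1 : nat, u.2 : nat).

Lemma pt_inj n : injective (@pt n).
Proof. by move=> [a b] [c d] [/val_inj-> /val_inj->]. Qed.

Definition hex_adj n : rel ('I_n * 'I_n) := fun u v => hex (pt u) (pt v) == 1.

Lemma hex_adj_sym n : symmetric (@hex_adj n).
Proof. by move=> u v; rewrite /hex_adj hexC. Qed.

Lemma hex_adj_irr n : irreflexive (@hex_adj n).
Proof. by move=> u; rewrite /hex_adj hex0. Qed.

Definition hex_graph n : graph ('I_n * 'I_n)%type :=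
  Graph (@hex_adj_sym n) (@hex_adj_irr n).

Lemma dist_hex_graph n u v :
  dist (hex_graph n) u v = ((hex (pt u) (pt v))%:Z)%:E.
Proof.
apply: (dist_potential (S := predT) (f := fun u => hex (pt u) (pt v))) => //.
- exact: hex0.
- move=> a b /eqP ab; apply: leq_trans (hex_triangle _ (pt b) _) _.
  by rewrite ab.
- by move=> a _ av; apply/pt_inj/hex_eq0; rewrite av.
- move=> a _ pos; have [[b c] /= [bn cn ab abv]] :=
    hex_step (u := pt a) (v := pt v) (ltn_ord _) (ltn_ord _) (ltn_ord _) (ltn_ord _) pos.
  by exists (Ordinal bn, Ordinal cn); split=> //; apply/eqP.
Qed.

(** * Distances along a cycle *)

Definition cyc_dist n i j : nat := minn (ndist i j) (n - ndist i j).

Definition cyc_succ n i : nat := if i.+1 == n then 0 else i.+1.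

Lemma cyc_succ_lt n i : i < n -> cyc_succ n i < n.
Proof. by rewrite /cyc_succ; case: eqP; lia. Qed.

Lemma cyc_dist_succ n i j : i < n -> j < n ->
  cyc_dist n i j <= (cyc_dist n (cyc_succ n i) j).+1 /\
  cyc_dist n (cyc_succ n i) j <= (cyc_dist n i j).+1.
Proof. by rewrite /cyc_dist /ndist /cyc_succ; case: eqP; lia. Qed.

Lemma cyc_dist_step n i j : i < n -> j < n -> 0 < cyc_dist n i j ->
  exists i', [/\ i' < n, cyc_succ n i = i' \/ cyc_succ n i' = i &
    cyc_dist n i j = (cyc_dist n i' j).+1].
Proof.
move=> lt_in lt_jn; rewrite /cyc_dist /ndist /cyc_succ => pos.
(* The test tells whether increasing the index, modulo [n], is a shortest way round from [i] to
   [j]. *)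
case up: ((i < j) && ((j - i).*2 <= n) || (j < i) && (n < (i - j).*2)).
  exists (if i.+1 == n then 0 else i.+1); case: eqP => ?; split; by [left|lia].
exists (if i == 0 then n.-1 else i.-1); case: eqP => ?; split; try lia.
  by right; rewrite ifT; lia.
by right; rewrite ifF; lia.
Qed.

Lemma next_nth_uniq (V : eqType) (x0 : V) c i : uniq c -> i < size c ->
  next c (nth x0 c i) = nth x0 c (cyc_succ (size c) i).
Proof.
case: c => // y p uc lt_ip.
rewrite next_nth mem_nth // index_uniq // /cyc_succ; case: eqP => [[->]|ni].
  by rewrite nth_default.
by apply: set_nth_default; move: lt_ip ni => /=; lia.
Qed.

Lemma dist_cycle (V : finType) (e : rel V) (c : seq V) (x0 : V) :
  uniq c ->
  (forall x y, e x y =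
     [&& x \in c, y \in c & (next c x == y) || (next c y == x)]) ->
  forall i j, i < size c -> j < size c ->
  dist e (nth x0 c i) (nth x0 c j) = ((cyc_dist (size c) i j)%:Z)%:E.
Proof.
move=> uc eE i j lt_i lt_j.
have idx a : a \in c -> exists2 k, k < size c & a = nth x0 c k.
  by move=> ac; exists (index a c); rewrite ?index_mem ?nth_index.
(* The potential has to be a function of the vertex, so [i] is recovered as an index. *)
have -> : cyc_dist (size c) i j = cyc_dist (size c) (index (nth x0 c i) c) j.
  by rewrite index_uniq.
apply: (dist_potential (S := mem c)
         (f := fun a => cyc_dist (size c) (index a c) j)).
- by rewrite index_uniq // /cyc_dist !ndist0 min0n.
- move=> a b; rewrite eE => /and3P[/idx[k lt_k ->] /idx[l lt_l ->]].
  rewrite !next_nth_uniq // !nth_uniq ?cyc_succ_lt // !index_uniq //.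
  case/orP=> /eqP<-; first by have [] := cyc_dist_succ lt_k lt_j.
  by have [] := cyc_dist_succ lt_l lt_j.
- move=> a /idx[k lt_k ->]; rewrite index_uniq // => d0; congr nth.
  by move: d0; rewrite /cyc_dist /ndist; lia.
- move=> a /idx[k lt_k ->]; rewrite index_uniq //.
  case/(cyc_dist_step lt_k lt_j) => l [lt_l kl kE].
  exists (nth x0 c l); rewrite index_uniq //; split=> //; first exact: mem_nth.
  rewrite eE !mem_nth //= !next_nth_uniq // !nth_uniq ?cyc_succ_lt //.
  by case: kl => ->; rewrite eqxx ?orbT.
- exact: mem_nth.
Qed.

(** * Geodesic cycles and outer diameter width of the rhombus *)

Lemma hex_graph_geodesic_cycle m (C : subgraph (hex_graph m)) n :
  is_cycle_of_length C n -> geodesic C -> n = 3.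
Proof.
case=> c [uc sc n3 Cc Ce] [_ geo].
apply/eqP; apply: contraT => n_neq3.
have x0 : 'I_m * 'I_m by case: c sc {uc Cc Ce} => [|x //] /= n0; lia.
pose P i := pt (nth x0 c i).
have hexP i j : i < n -> j < n -> hex (P i) (P j) = cyc_dist n i j.
  rewrite -sc => lt_i lt_j; have [] // : ((hex (P i) (P j))%:Z)%:E =
      ((cyc_dist (size c) i j)%:Z)%:E :> \bar int.
  by rewrite -(dist_cycle x0 uc Ce) // -dist_hex_graph geo ?Cc ?mem_nth.
(* The two cycle neighbours of [P 0] are at cyclic distance two as soon as [n] is at least four. *)
suff : hex (P 1) (P n.-1) <= 1 by rewrite hexP /cyc_dist /ndist; lia.
(* The antipode of index [0] is [k.+1] for even [n]; for odd [n] the antipodes are [k.+1] and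
   [k.+2]. *)
have [k [k_gt0 [nE|nE]]] : exists k, 0 < k /\ (n = k.+1.*2 \/ n = k.+1.*2.+1).
  by exists n./2.-1; have := odd_double_half n; case: odd; lia.
- apply: (@hex_even (P k.+1) (P 0) _ _ k); rewrite hexP nE /cyc_dist /ndist; lia.
- apply: (@hex_odd (P k.+1) (P k.+2) (P 0) _ _ k);
    rewrite hexP nE /cyc_dist /ndist; lia.
Qed.

Lemma odw_hex_graph n : n <= odw (hex_graph n.+1).
Proof.
rewrite /odw; case: ex_minnP => k /asboolP[D Dk] _.
have conn := tree_connected (td_treeP D).
pose row (i : 'I_n.+1) t := exists j, (i, j) \in bag D t.
pose col (j : 'I_n.+1) t := exists i, (i, j) \in bag D t.
have row_cvx i : convex (td_tree D) (row i).
  apply: (eq_convex _ (walk_convex (f := fun j => (i, inord j)) (n := n) _)) =>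
      [t|j lt_jn]; last by rewrite /= /hex_adj /hex /ndist /= !inordK; lia.
  split=> [[j _]|[j ijt]]; first by exists (inord j).
  by exists j; rewrite ?inord_val // -ltnS.
have col_cvx j : convex (td_tree D) (col j).
  apply: (eq_convex _ (walk_convex (f := fun i => (inord i, j)) (n := n) _)) =>
      [t|i lt_in]; last by rewrite /= /hex_adj /hex /ndist /= !inordK; lia.
  split=> [[i _]|[i ijt]]; first by exists (inord i).
  by exists i; rewrite ?inord_val // -ltnS.
pose cross (u : 'I_n.+1 * 'I_n.+1) t := row u.1 t \/ col u.2 t.
have [||t [_ tP]] := convex_Helly (adj_sym (td_tree D)) conn (F := cross) _ _
    (ord0, ord0) (enum {: 'I_n.+1 * 'I_n.+1}).
- case=> i j; have [t ijt] := bag_cover D (i, j).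
  apply: (convex_setU (adj_sym (td_tree D)) conn (s := t)) => //=.
    by exists j.
  by exists i.
(* The row of the first cross meets the column of the second in [(i, l)]. *)
- move=> [i j] [i' l]; have [t ilt] := bag_cover D (i, l).
  by exists t; split; [left; exists l | right; exists i].
have {}tP i j : row i t \/ col j t by apply: (tP (i, j)); rewrite mem_enum.
suff [u [v [ut vt uv]]] : exists u v, [/\ u \in bag D t, v \in bag D t &
    n <= hex (pt u) (pt v)].
  apply: leq_trans uv _; rewrite -lez_nat -lee_fin -dist_hex_graph -Dk.
  apply: (le_bigmax_cond _ (j := (u, v)) (fun uv => dist _ uv.1 uv.2)).
  by apply/asboolP; exists t; rewrite ut.
(* If the bag misses row [i], it meets every cross [(i, j)] in column [j]. Either way it meets two
   opposite sides, whose indices [0] and [n] differ by [n]. *)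
have [rows|/existsNP[i nrow]] := pselect (forall i, row i t).
  have [j0 t0] := rows ord0; have [j1 t1] := rows ord_max.
  by exists (ord0, j0), (ord_max, j1); split=> //; rewrite /hex /ndist /=; lia.
have cols j : col j t by case: (tP i j).
have [i0 t0] := cols ord0; have [i1 t1] := cols ord_max.
by exists (i0, ord0), (i1, ord_max); split=> //; rewrite /hex /ndist /=; lia.
Qed.

Theorem theorem2p5 (N : int) :
  exists (V : finType) (G : graph V),
    (N <= Posz (odw G))%R /\
    (forall (C : subgraph G) (n : nat),
        is_cycle_of_length C n -> geodesic C -> n = 3).
Proof.
(* The absolute value handles negative [N]; a side with [n.+1] vertices has length [n]. *)
exists ('I_(absz N).+1 * 'I_(absz N).+1)%type, (hex_graph (absz N).+1).
split; last exact: hex_graph_geodesic_cycle.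
by apply: le_trans (lez_abs N) _; rewrite lez_nat odw_hex_graph.
Qed.
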